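(* Let $m$ and $n$ be positive integers with $n$ odd, and let $q=2^m$. Let $L(x)=\sum_{i=0}^{m-1}a_ix^{2^i}$ with $a_i\in\mathbb{F}_q$ be a linearized polynomial over $\mathbb{F}_q$ such that $xL(x)+vx$ is a complete permutation polynomial over $\mathbb{F}_q$ for some $v\in\mathbb{F}_q\setminus\{0,1\}$. Then for every $u\in\mathbb{F}_q$, the polynomial \[F(x)=x\left(L(\mathrm{tr}(x))+u\,\mathrm{tr}(x)+ux\right)+vx\] is a complete permutation polynomial over $\mathbb{F}_{q^n}$.
   Context: A polynomial $f\in\mathbb{F}_Q[x]$ is a permutation polynomial over $\mathbb{F}_Q$ if it induces a bijection of $\mathbb{F}_Q$; it is a complete permutation polynomial over $\mathbb{F}_Q$ if both $f(x)$ and $f(x)+x$ are permutation polynomials over $\mathbb{F}_Q$. Here $\mathrm{tr}$ denotes the relative trace from $\mathbb{F}_{q^n}$ to $\mathbb{F}_q$, $\mathrm{tr}(x)=\sum_{i=0}^{n-1}x^{q^i}$. *)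

(* Defs.v *)
From HB Require Import structures.
From mathcomp Require Import all_boot all_order all_algebra all_field.
Set Implicit Arguments. Unset Strict Implicit. Unset Printing Implicit Defensive.
Import GRing.Theory.
Local Open Scope ring_scope.

Definition permutation_poly (R : nzRingType) (p : {poly R}) : Prop :=
  bijective (fun x : R => p.[x]).

Definition complete_permutation_poly (R : nzRingType) (p : {poly R}) : Prop :=
  permutation_poly p /\ permutation_poly (p + 'X).

Definition linearized2_poly (R : nzRingType) (m : nat) (a : 'I_m -> R) :
    {poly R} :=
  \sum_(i < m) a i *: 'X^(2 ^ i).

(* The relative trace of F_{q^n} over F_q, as a formal polynomial with
   coefficients in R = F_{q^n}. *)
Definition trace_poly (R : nzRingType) (q n : nat) : {poly R} :=
  \sum_(i < n) 'X^(q ^ i).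

(* Main.v *)
Require Import Defs.
From HB Require Import structures.
From mathcomp Require Import all_boot all_order all_algebra all_field.
From mathcomp Require Import ring.
Set Implicit Arguments.
Unset Strict Implicit.
Unset Printing Implicit Defensive.
Import GRing.Theory.
Local Open Scope ring_scope.

(** Let [F(x) = x (L(tr x) + u tr x + u x) + w x] with [w] nonzero, and suppose
[F(x) = F(y)].  Taking traces, as [tr (x^2) = (tr x)^2] the terms in [u] cancel
and [t L(t) + w t] takes the same value at [t = tr x] and [t = tr y], whence
[tr x = tr y = t].  Then [d = x - y] satisfies [d (c + u d) = 0] with
[c = L(t) + u t + w] in F_q.  If [d] is nonzero then [u d = c]; either
[u = 0], and [t (L(t) + w) = 0 = 0 (L(0) + w)] forces [t = 0] and [w = 0],
or [d] lies in F_q, and [0 = tr d = n d = d] because [n] is odd.  Complete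
permutation is the case [w = v] together with [w = v + 1]. *)

(** A finite-dimensional space over a finite field is finite, so counting applies; [finvect_type K]
    is [K] with that finite structure. *)
Lemma fieldExt_inj_bij (F : finFieldType) (K : fieldExtType F) (f : K -> K) :
  injective f -> bijective f.
Proof. exact: (@injF_bij (finvect_type K)). Qed.

Lemma pchar2_fieldExt (m : nat) (F : finFieldType) (K : fieldExtType F) :
  #|F| = (2 ^ m)%N -> 2%N \in [pchar K].
Proof. by move=> cardF; rewrite pchar_lalg (card_finPcharP cardF). Qed.

Lemma exprDn_pow2 (R : comNzRingType) (k : nat) (x y : R) :
  2%N \in [pchar R] -> (x + y) ^+ (2 ^ k) = x ^+ (2 ^ k) + y ^+ (2 ^ k).
Proof.
by move=> R2; rewrite exprDn_pchar // (eq_pnat _ (pcharf_eq R2)) pnatX pnat_id.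
Qed.

Lemma expr_sum_pow2 (R : comNzRingType) (k : nat) (I : Type) (r : seq I)
    (P : pred I) (f : I -> R) :
  2%N \in [pchar R] ->
  (\sum_(i <- r | P i) f i) ^+ (2 ^ k) = \sum_(i <- r | P i) f i ^+ (2 ^ k).
Proof.
move=> R2; apply: (big_morph (fun x => x ^+ (2 ^ k))) => [x y|].
  exact: exprDn_pow2.
by rewrite expr0n expn_eq0.
Qed.

Lemma natr_odd_pchar2 (R : nzRingType) (n : nat) :
  2%N \in [pchar R] -> odd n -> n%:R = 1 :> R.
Proof. by move=> R2 n_odd; rewrite -(GRing.natr_mod_pchar R2) modn2 n_odd. Qed.

Lemma horner_trace_poly (R : nzRingType) (q n : nat) (x : R) :
  (trace_poly R q n).[x] = \sum_(i < n) x ^+ (q ^ i).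
Proof. by rewrite horner_sum; apply: eq_bigr => i _; rewrite hornerXn. Qed.

Lemma horner_linearized2_poly0 (R : nzRingType) (m : nat) (a : 'I_m -> R) :
  (linearized2_poly a).[0] = 0.
Proof.
rewrite horner_sum big1 // => i _.
by rewrite hornerZ hornerXn expr0n expn_eq0 mulr0.
Qed.

Lemma trace_polyD (R : comNzRingType) (m n : nat) (x y : R) :
  2%N \in [pchar R] ->
  (trace_poly R (2 ^ m) n).[x + y] =
  (trace_poly R (2 ^ m) n).[x] + (trace_poly R (2 ^ m) n).[y].
Proof.
move=> R2; rewrite !horner_trace_poly -big_split /=.
by apply: eq_bigr => i _; rewrite -expnM exprDn_pow2.
Qed.

Lemma trace_polyX2 (R : comNzRingType) (q n : nat) (x : R) :
  2%N \in [pchar R] ->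
  (trace_poly R q n).[x ^+ 2] = (trace_poly R q n).[x] ^+ 2.
Proof.
move=> R2; rewrite !horner_trace_poly (expr_sum_pow2 1) //.
by apply: eq_bigr => i _; rewrite exprAC.
Qed.

Lemma expf_card_iter (F : finFieldType) (i : nat) (c : F) :
  c ^+ (#|F| ^ i) = c.
Proof. by elim: i => [|i IHi]; rewrite ?expr1 // expnSr exprM IHi expf_card. Qed.

(** Each exponent is a power of [#|F|], and raising to it fixes the scalar [c]. *)
Lemma trace_polyZ (F : finFieldType) (K : fieldExtType F) (n : nat) (c : F)
    (x : K) :
  (trace_poly K #|F| n).[c *: x] = c *: (trace_poly K #|F| n).[x].
Proof.
rewrite !horner_trace_poly scaler_sumr.
by apply: eq_bigr => i _; rewrite exprZn expf_card_iter.
Qed.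

Lemma trace_poly1 (R : nzRingType) (q n : nat) : (trace_poly R q n).[1] = n%:R.
Proof.
rewrite horner_trace_poly (eq_bigr (fun=> 1)) => [|i _]; last by rewrite expr1n.
by rewrite sumr_const card_ord.
Qed.

(** Raising to the power [q = 2 ^ m] permutes the terms of the trace cyclically, and the elements of
    [K] fixed by this power are those of [F]. *)
Lemma trace_poly_alg (m : nat) (F : finFieldType) (K : fieldExtType F) (x : K) :
  #|F| = (2 ^ m)%N ->
  exists t : F, (trace_poly K (2 ^ m) (\dim {:K})).[x] = t%:A.
Proof.
move=> cardF; apply/vlineP; rewrite -[<[1]>%VS]/(1%VS : {vspace K}).
rewrite (Fermat's_little_theorem 1%AS) dimv1 expn1 cardF.
rewrite horner_trace_poly expr_sum_pow2; last exact: pchar2_fieldExt cardF.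
rewrite (eq_bigr (fun i : 'I__ => x ^+ ((2 ^ m) ^ i.+1))) => [|i _]; last first.
  by rewrite -exprM -expnSr.
have xq : x ^+ ((2 ^ m) ^ \dim {:K}) = x.
  by apply/eqP; rewrite -cardF -(Fermat's_little_theorem (aspacef K)) memvf.
rewrite -(big_mkord xpredT (fun i => x ^+ ((2 ^ m) ^ i.+1))).
rewrite -(big_mkord xpredT (fun i => x ^+ ((2 ^ m) ^ i))).
(* The dimension is positive, so each sum can be split: by [xq] the last term of the shifted sum is
   [x], the first term of the original one. *)
case: (\dim _) xq (adim_gt0 (aspacef K)) => // d xq _.
by rewrite big_nat_recr //= xq big_nat_recl // expr1 addrC.
Qed.

Lemma trace_poly_permutation (m n : nat) (F : finFieldType)
    (K : fieldExtType F) (a : 'I_m -> F) (u w : F) :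
  odd n -> #|F| = (2 ^ m)%N -> \dim {:K} = n -> w != 0 ->
  permutation_poly ('X * linearized2_poly a + w *: 'X) ->
  let tr := trace_poly K (2 ^ m) n in
  permutation_poly
    ('X * (map_poly (in_alg K) (linearized2_poly a) \Po tr + u%:A *: tr
           + u%:A *: 'X) + w%:A *: 'X).
Proof.
move=> n_odd cardF dimK w0 /bij_inj Linj tr.
set L := linearized2_poly a in Linj *.
have K2 : 2%N \in [pchar K] := pchar2_fieldExt K cardF.
have trZ c x : tr.[c *: x] = c *: tr.[x] by rewrite /tr -cardF trace_polyZ.
have trD x y : tr.[x + y] = tr.[x] + tr.[y] by exact: trace_polyD.
have tr_alg x : exists t, tr.[x] = t%:A.
  by rewrite /tr -dimK; exact: trace_poly_alg.
have algM b c : (b * c)%:A = b%:A * c%:A :> K by exact: (rmorphM (in_alg K)).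
have HL t : (map_poly (in_alg K) L).[t%:A] = L.[t]%:A.
  exact: (horner_map (in_alg K) L t).
(* Where the trace is [t], the polynomial acts as a quadratic with coefficients in [F]; points of
   equal trace share this quadratic. *)
have FE x t : tr.[x] = t%:A ->
    ('X * (map_poly (in_alg K) L \Po tr + u%:A *: tr + u%:A *: 'X)
      + w%:A *: 'X).[x] = (L.[t] + u * t + w) *: x + u *: x ^+ 2.
  move=> trx; rewrite !hornerE horner_comp trx.
  rewrite HL -[_ *: x]mulr_algl -[u *: x ^+ 2]mulr_algl !scalerDl algM.
  by move: L.[t]%:A u%:A w%:A t%:A => l u' w' t'; ring.
have trF x t : tr.[x] = t%:A ->
    tr.[(L.[t] + u * t + w) *: x + u *: x ^+ 2]
    = ('X * L + w *: 'X).[t]%:A.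
  move=> trx; rewrite trD !trZ trace_polyX2 // -/tr trx !hornerE.
  rewrite expr2 -algM !scalerA -scalerDl; congr (_%:A).
  have F2 : 2%N \in [pchar F] by rewrite -(pchar_lalg K).
  have -> : (L.[t] + u * t + w) * t + u * (t * t)
            = t * L.[t] + w * t + (u * (t * t) + u * (t * t)) by ring.
  by rewrite addrr_pchar2 ?addr0.
apply: fieldExt_inj_bij => x y.
have [t trx] := tr_alg x; have [s tr_y] := tr_alg y.
rewrite (FE _ _ trx) (FE _ _ tr_y) => Fxy.
have ts : t = s.
  apply: Linj; have := trF _ _ tr_y.
  by rewrite -Fxy (trF _ _ trx) => /(fmorph_inj (in_alg K)).
subst s.
apply/eqP; rewrite -subr_eq0; apply/negPn/negP => d0.
set d := x - y in d0; set c := L.[t] + u * t + w in Fxy.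
have trd : tr.[d] = 0 by rewrite /d -scaleN1r trD trZ trx tr_y scaleN1r subrr.
(* Subtracting the two equal quadratic values gives [d * (c%:A + u *: d) = 0], since squaring is
   additive in characteristic 2; then [d] cancels. *)
have cud : c%:A + u *: d = 0.
  have d2 : d * d = x ^+ 2 - y ^+ 2.
    by rewrite -expr2 /d !(oppr_pchar2 K2) (exprDn_pow2 1).
  apply: (mulfI d0); rewrite mulr0 mulrDr -!scalerAr mulr1 d2 !scalerBr.
  by rewrite addrACA -opprD Fxy subrr.
have [u0|u0] := eqVneq u 0.
  move: cud; rewrite u0 scale0r addr0 => /eqP.
  rewrite scaler_eq0 oner_eq0 orbF /c u0 mul0r addr0 => /eqP Ltw.
  have t0 : t = 0.
    by apply: Linj; rewrite !hornerE -[w * t]mulrC -mulrDr Ltw mulr0.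
  move: Ltw w0; rewrite t0 horner_linearized2_poly0 add0r => ->.
  by rewrite eqxx.
have dE : d = (- (u^-1 * c)) *: 1.
  apply: (scalerI u0); rewrite scalerA mulrN mulVKf // scaleNr.
  by apply/eqP; rewrite -addr_eq0 addrC cud.
move: trd; rewrite dE trZ trace_poly1 natr_odd_pchar2 // -dE => d00.
by rewrite d00 eqxx in d0.
Qed.

(* F is the field F_q; K is its extension F_{q^n}, of degree n; in_alg K is
   the embedding of F into K, and c%:A the image of c : F in K. *)
Theorem theorem3 (m n q : nat) (m_gt0 : (0 < m)%N) (n_gt0 : (0 < n)%N)
    (n_odd : odd n) (qE : q = (2 ^ m)%N)
    (F : finFieldType) (cardF : #|F| = q)
    (K : fieldExtType F) (dimK : \dim {:K} = n)
    (a : 'I_m -> F) (v : F) (v_neq0 : v != 0) (v_neq1 : v != 1)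
    (hv : complete_permutation_poly ('X * linearized2_poly a + v *: 'X))
    (u : F) :
  let L : {poly K} := map_poly (in_alg K) (linearized2_poly a) in
  let tr : {poly K} := trace_poly K q n in
  complete_permutation_poly
    ('X * (L \Po tr + u%:A *: tr + u%:A *: 'X) + v%:A *: 'X).
Proof.
move=> L tr; subst q; rewrite /tr /L {L tr}.
have [hv0 hv1] := hv; split; first exact: trace_poly_permutation.
have addX (R : nzRingType) (p : {poly R}) (b : R) :
  p + b *: 'X + 'X = p + (b + 1) *: 'X by rewrite -addrA scalerDl scale1r.
have v1E : v%:A + 1 = (v + 1)%:A :> K by rewrite scalerDl scale1r.
rewrite addX v1E.
apply: trace_poly_permutation => //; last by rewrite -addX.
(* What remains is [v + 1 != 0]; as [-1 = 1] here, this is [v != 1]. *)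
have F2 : 2%N \in [pchar F] by rewrite (card_finPcharP cardF).
by rewrite addr_eq0 (oppr_pchar2 F2).
Qed.
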